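(* For every integer $k\ge1$, the spaces of $\alpha^k$-derivations of the following $2$-dimensional complex multiplicative $3$-Hom-Lie superalgebras with $\mathfrak{g}_{\bar0}=\mathbb{C}e_0$, $\mathfrak{g}_{\bar1}=\mathbb{C}e_1$ are as follows (matrices with respect to $(e_0,e_1)$, acting by columns). 1. For the abelian algebra $\mathfrak{g}^{1,a,b}_{1;1}$ with $\alpha(e_0)=ae_0$, $\alpha(e_1)=be_1$ ($a,b\in\mathbb{C}$): $$\operatorname{Der}_{\alpha^k}(\mathfrak{g})_{\bar0}=\left\{\begin{pmatrix}m&0\\ 0&q\end{pmatrix}: m,q\in\mathbb{C}\right\},$$ and $\operatorname{Der}_{\alpha^k}(\mathfrak{g})_{\bar1}=\left\{\begin{pmatrix}0&n\\ p&0\end{pmatrix}: n,p\in\mathbb{C}\right\}$ if $a=b$, and $\{0\}$ if $a\ne b$. 2. For $\mathfrak{g}^{2,a}_{1;1}$: $[e_1,e_1,e_1]=e_1$, $\alpha(e_0)=ae_0$, $\alpha(e_1)=0$ ($a\in\mathbb{C}$): $$\operatorname{Der}_{\alpha^k}(\mathfrak{g})_{\bar0}=\left\{\begin{pmatrix}m&0\\ 0&0\end{pmatrix}: m\in\mathbb{C}\right\},$$ and $\operatorname{Der}_{\alpha^k}(\mathfrak{g})_{\bar1}=\left\{\begin{pmatrix}0&0\\ p&0\end{pmatrix}: p\in\mathbb{C}\right\}$ if $a=0$, and $\{0\}$ if $a\neq0$. 3. For $\mathfrak{g}^{3}_{1;1}$: $[e_1,e_1,e_0]=e_0$, $\alpha=0$: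 $$\operatorname{Der}_{\alpha^k}(\mathfrak{g})_{\bar0}=\left\{\begin{pmatrix}0&0\\ 0&q\end{pmatrix}: q\in\mathbb{C}\right\},\qquad \operatorname{Der}_{\alpha^k}(\mathfrak{g})_{\bar1}=\left\{\begin{pmatrix}0&n\\ 0&0\end{pmatrix}: n\in\mathbb{C}\right\}.$$ 4. For $\mathfrak{g}^{4,\tau}_{1;1}$: $[e_1,e_1,e_0]=e_0$, $[e_1,e_1,e_1]=\tau e_1$, $\alpha=0$ ($\tau\in\mathbb{C}^*$): $\operatorname{Der}_{\alpha^k}(\mathfrak{g})=\{0\}$. Therefore, the complete $2$-dimensional complex multiplicative $3$-Hom-Lie superalgebras of superdimension $(1|1)$ are (up to isomorphism) precisely $\mathfrak{g}^{4,\tau}_{1;1}$, $\tau\in\mathbb{C}^{*}$.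
   Context: A multiplicative $3$-Hom-Lie superalgebra $(\mathfrak{g},[\cdot,\cdot,\cdot],\alpha)$ is a $\mathbb{Z}_2$-graded space $\mathfrak{g}=\mathfrak{g}_{\bar0}\oplus\mathfrak{g}_{\bar1}$ with an even trilinear bracket and an even linear map $\alpha$ such that: $\alpha([x,y,z])=[\alpha(x),\alpha(y),\alpha(z)]$; for homogeneous elements $[x,y,z]=-(-1)^{|x||y|}[y,x,z]$ and $[x,y,z]=-(-1)^{|y||z|}[x,z,y]$; and for homogeneous elements $$[\alpha(x_1),\alpha(x_2),[y_1,y_2,y_3]]=\sum_{i=1}^3(-1)^{(|x_1|+|x_2|)(|y_1|+\cdots+|y_{i-1}|)}B_i,$$ where $B_1=[[x_1,x_2,y_1],\alpha(y_2),\alpha(y_3)]$, $B_2=[\alpha(y_1),[x_1,x_2,y_2],\alpha(y_3)]$, $B_3=[\alpha(y_1),\alpha(y_2),[x_1,x_2,y_3]]$. Superdimension $(1|1)$ means $\dim\mathfrak{g}_{\bar0}=\dim\mathfrak{g}_{\bar1}=1$. Isomorphisms are bijective even linear maps preserving brackets and intertwining the maps $\alpha$. Brackets of basis elements not listed and not determined by super-skew-symmetry are zero. Every multiplicative $3$-Hom-Lie superalgebra of superdimension $(1|1)$ over $\mathbb{C}$ is isomorphic to a member of exactly one of the four families in the claim. With $\alpha^0=\mathrm{id}$, an $\alpha^k$-derivation is a homogeneous linear map $D$ of parity $|D|$ with $D\alpha=\alpha D$ and $D([x_1,x_2,x_3])=[D(x_1),\alpha^k(x_2),\alpha^k(x_3)]+(-1)^{|D||x_1|}[\alpha^k(x_1),D(x_2),\alpha^k(x_3)]+(-1)^{|D|(|x_1|+|x_2|)}[\alpha^k(x_1),\alpha^k(x_2),D(x_3)]$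 for homogeneous $x_i$. $\operatorname{Der}_{\alpha^k}(\mathfrak{g})_{\bar0}$, $\operatorname{Der}_{\alpha^k}(\mathfrak{g})_{\bar1}$ are the spaces of even and odd ones, and $\operatorname{Der}_{\alpha^k}(\mathfrak{g})$ is their direct sum. $\operatorname{Inn}_{\alpha^k}(\mathfrak{g})\subseteq\operatorname{Der}_{\alpha^{k+1}}(\mathfrak{g})$ is the span of the maps $y\mapsto[x_1,x_2,\alpha^k(y)]$ with $x_1,x_2$ homogeneous and $\alpha(x_i)=x_i$. The center is $C(\mathfrak{g})=\{z:[z,\mathfrak{g},\mathfrak{g}]=[\mathfrak{g},z,\mathfrak{g}]=[\mathfrak{g},\mathfrak{g},z]=0\}$. $\mathfrak{g}$ is complete if $C(\mathfrak{g})=\{0\}$ and $\operatorname{Der}_{\alpha^{k+1}}(\mathfrak{g})=\operatorname{Inn}_{\alpha^k}(\mathfrak{g})$ for every integer $k\ge0$. *)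

(* Defs.v *)
From HB Require Import structures.
From mathcomp Require Import all_boot all_order all_algebra.
From mathcomp Require Import ring.
From mathcomp Require Export complex.
From mathcomp Require Export classical_sets reals.
Set Implicit Arguments.
Unset Strict Implicit.
Unset Printing Implicit Defensive.
Import GRing.Theory.
Local Open Scope ring_scope.
Local Open Scope classical_set_scope.

(* Elements of Z_2 are booleans: false is the degree 0, true the degree 1 and
   addb, written (+), the addition.  In exponents of -1 they are coerced to the
   naturals 0 and 1. *)
Record mult3HomLieSuper (K : fieldType) := Mult3HomLieSuper {
  carrier :> vectType K;
  part : bool -> {vspace carrier};
  br : carrier -> carrier -> carrier -> carrier;
  twist : 'End(carrier);
  part_sum : (part false + part true = fullv)%VS;
  part_cap : (part false :&: part true = 0)%VS;
  br_linear1 : forall y z, linear (fun x => br x y z);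
  br_linear2 : forall x z, linear (fun y => br x y z);
  br_linear3 : forall x y, linear (fun z => br x y z);
  br_even : forall i j k x y z,
    x \in part i -> y \in part j -> z \in part k ->
    br x y z \in part (i (+) j (+) k);
  twist_even : forall i x, x \in part i -> twist x \in part i;
  twist_br : forall x y z, twist (br x y z) = br (twist x) (twist y) (twist z);
  br_skew12 : forall i j k x y z,
    x \in part i -> y \in part j -> z \in part k ->
    br x y z = - ((-1) ^+ (i * j)%N *: br y x z);
  br_skew23 : forall i j k x y z,
    x \in part i -> y \in part j -> z \in part k ->
    br x y z = - ((-1) ^+ (j * k)%N *: br x z y);
  hom_jacobi : forall i1 i2 j1 j2 j3 x1 x2 y1 y2 y3,
    x1 \in part i1 -> x2 \in part i2 ->
    y1 \in part j1 -> y2 \in part j2 -> y3 \in part j3 ->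
    br (twist x1) (twist x2) (br y1 y2 y3) =
      br (br x1 x2 y1) (twist y2) (twist y3)
      + (-1) ^+ ((i1 + i2) * j1)%N *:
          br (twist y1) (br x1 x2 y2) (twist y3)
      + (-1) ^+ ((i1 + i2) * (j1 + j2))%N *:
          br (twist y1) (twist y2) (br x1 x2 y3)
}.

Section Notions.
Variable K : fieldType.
Implicit Types g h : mult3HomLieSuper K.

Definition superdim g (m n : nat) : Prop :=
  \dim (part g false) = m /\ \dim (part g true) = n.

Definition isomorphic g h : Prop :=
  exists f : 'Hom(carrier g, carrier h),
    [/\ bijective f,
        forall i x, x \in part g i -> f x \in part h i,
        forall x y z, f (br x y z) = br (f x) (f y) (f z)
      & forall x, f (twist g x) = twist h (f x)].

Definition twistn g (k : nat) (x : g) : g := iter k (twist g) x.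

(* The alpha^k-derivations of parity d; every parity contains the zero map. *)
Definition derh g (k : nat) (d : bool) : set 'End(carrier g) :=
  [set D | [/\ forall i x, x \in part g i -> D x \in part g (d (+) i),
               forall x, D (twist g x) = twist g (D x)
             & forall i1 i2 i3 x1 x2 x3,
                 x1 \in part g i1 -> x2 \in part g i2 -> x3 \in part g i3 ->
                 D (br x1 x2 x3) =
                   br (D x1) (twistn k x2) (twistn k x3)
                   + (-1) ^+ (d * i1)%N *:
                       br (twistn k x1) (D x2) (twistn k x3)
                   + (-1) ^+ (d * (i1 + i2))%N *:
                       br (twistn k x1) (twistn k x2) (D x3)]].
Arguments derh : clear implicits.

Definition der g (k : nat) : set 'End(carrier g) :=
  [set D | exists D0 D1,
     [/\ derh g k false D0, derh g k true D1 & D = D0 + D1]].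
Arguments der : clear implicits.

Definition inn_gen g (k : nat) : set 'End(carrier g) :=
  [set D | exists i1 i2 x1 x2,
     [/\ x1 \in part g i1, x2 \in part g i2,
         twist g x1 = x1, twist g x2 = x2
       & forall y, D y = br x1 x2 (twistn k y)]].
Arguments inn_gen : clear implicits.

Definition inn g (k : nat) : set 'End(carrier g) :=
  [set D | exists s : seq 'End(carrier g),
     (forall E, E \in s -> inn_gen g k E) /\ D \in <<s>>%VS].
Arguments inn : clear implicits.

Definition center g : set g :=
  [set z | forall x y, [/\ br z x y = 0, br x z y = 0 & br x y z = 0]].
Arguments center : clear implicits.

Definition complete g : Prop :=
  center g = [set 0] /\ forall k : nat, der g k.+1 = inn g k.

End Notions.
Arguments derh {K} g k d.
Arguments der {K} g k.
Arguments inn_gen {K} g k.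
Arguments inn {K} g k.
Arguments center {K} g.

Section Families.
Variable K : fieldType.

(* The basis (e_0, e_1) of the column vectors of size 2; e_i spans the part of
   degree i. *)
Definition e (i : bool) : 'cV[K]_2 := delta_mx (if i then 1 else 0) 0.

(* The matrix with rows (m, n) and (p, q). *)
Definition mx2 (m n p q : K) : 'M[K]_2 :=
  \matrix_(i, j) if i == 0 then (if j == 0 then m else n)
                  else (if j == 0 then p else q).

Definition endo (M : 'M[K]_2) : 'End('cV[K]_2) := linfun (mulmx M).

Definition part11 (i : bool) : {vspace 'cV[K]_2} := <[e i]>%VS.

(* The super-skew-symmetric trilinear bracket with [e_1, e_1, e_0] = c e_0 and
   [e_1, e_1, e_1] = t e_1: skew-symmetry forces [e_1, e_0, e_1] = - c e_0 and
   [e_0, e_1, e_1] = c e_0, and brackets with two entries e_0 vanish. *)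
Definition br11 (c t : K) (x y z : 'cV[K]_2) : 'cV[K]_2 :=
  let x0 := x 0 0 in let x1 := x 1 0 in
  let y0 := y 0 0 in let y1 := y 1 0 in
  let z0 := z 0 0 in let z1 := z 1 0 in
  (c * (x1 * y1 * z0 - x1 * y0 * z1 + x0 * y1 * z1)) *: e false
  + (t * (x1 * y1 * z1)) *: e true.

Lemma eE (i : bool) j : e i j 0 = (i == (j == 1))%:R.
Proof.
by rewrite mxE eqxx andbT; case: j i => [[|[|//]] ?] [].
Qed.

Lemma colP2 (x y : 'cV[K]_2) : x 0 0 = y 0 0 -> x 1 0 = y 1 0 -> x = y.
Proof.
move=> h0 h1; apply/colP => -[[|[|//]] p].
  by rewrite (_ : Ordinal p = 0) //; exact: val_inj.
by rewrite (_ : Ordinal p = 1) //; exact: val_inj.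
Qed.

Lemma br11_0E c t x y z : br11 c t x y z 0 0 =
  c * (x 1 0 * y 1 0 * z 0 0 - x 1 0 * y 0 0 * z 1 0 + x 0 0 * y 1 0 * z 1 0).
Proof. by rewrite mxE [X in X + _]mxE [X in _ + X]mxE !eE /= mulr1 mulr0 addr0. Qed.

Lemma br11_1E c t x y z : br11 c t x y z 1 0 = t * (x 1 0 * y 1 0 * z 1 0).
Proof. by rewrite mxE [X in X + _]mxE [X in _ + X]mxE !eE /= mulr1 mulr0 add0r. Qed.

Let e00 : e false 0 0 = 1. Proof. by rewrite eE. Qed.
Let e01 : e false 1 0 = 0. Proof. by rewrite eE. Qed.
Let e10 : e true 0 0 = 0. Proof. by rewrite eE. Qed.
Let e11 : e true 1 0 = 1. Proof. by rewrite eE. Qed.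
Let eEs := (e00, e01, e10, e11).

Lemma br11_10 c t : br11 c t (e true) (e true) (e false) = c *: e false.
Proof. by apply: colP2; rewrite [RHS]mxE ?br11_0E ?br11_1E ?eEs; ring. Qed.

Lemma br11_11 c t : br11 c t (e true) (e true) (e true) = t *: e true.
Proof. by apply: colP2; rewrite [RHS]mxE ?br11_0E ?br11_1E ?eEs; ring. Qed.

Lemma br11_00 c t i : br11 c t (e false) (e false) (e i) = 0.
Proof.
by apply: colP2; rewrite [RHS]mxE ?br11_0E ?br11_1E ?eEs; ring.
Qed.

Lemma mem_part11 i x : (x \in part11 i) = (x (if i then 0 else 1) 0 == 0).
Proof.
apply/vlineP/eqP => [[k ->]|].
  by case: i; rewrite mxE eE /= mulr0.
case: i => h; [exists (x 1 0)|exists (x 0 0)];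
  by apply: colP2; rewrite mxE eE ?h ?(mulr0, mulr1).
Qed.

Lemma endo0E m n p q x :
  endo (mx2 m n p q) x 0 0 = m * x 0 0 + n * x 1 0.
Proof.
by rewrite lfunE /= mxE big_ord_recl big_ord1 !mxE (_ : lift _ _ = 1) //;
  exact: val_inj.
Qed.

Lemma endo1E m n p q x :
  endo (mx2 m n p q) x 1 0 = p * x 0 0 + q * x 1 0.
Proof.
by rewrite lfunE /= mxE big_ord_recl big_ord1 !mxE (_ : lift _ _ = 1) //;
  exact: val_inj.
Qed.

(* The algebra on K^2 with bracket br11 c t and alpha = diag (a, b), under a
   condition which makes it a multiplicative 3-Hom-Lie superalgebra. *)
Section Standard.
Variables c t a b : K.
Hypothesis ok : (c = 0 /\ t = 0) \/ (b = 0 /\ c * a = 0).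

Let P := part11.
Let B := br11 c t.
Let A := endo (mx2 a 0 0 b).
Let E := (br11_0E, br11_1E, endo0E, endo1E).

Lemma part11_sum : (P false + P true = fullv)%VS.
Proof.
apply/eqP; rewrite eqEsubv subvf /=; apply/subvP => x _.
rewrite (_ : x = x 0 0 *: e false + x 1 0 *: e true).
  by apply: memv_add; rewrite memvZ ?memv_line.
by apply: colP2; rewrite [RHS]mxE [X in X + _]mxE [X in _ + X]mxE !eE /=; ring.
Qed.

Lemma part11_cap : (P false :&: P true = 0)%VS.
Proof.
apply/eqP; rewrite -subv0; apply/subvP => x.
rewrite memv_cap !mem_part11 memv0 => /andP[/eqP h1 /eqP h0].
by apply/eqP/colP2; rewrite ?h0 ?h1 mxE.
Qed.

Lemma br11_linear1 y z : linear (fun x => B x y z).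
Proof.
move=> k x x'; apply: colP2; rewrite [RHS]mxE [X in _ = X + _]mxE !E !mxE; ring.
Qed.

Lemma br11_linear2 x z : linear (fun y => B x y z).
Proof.
move=> k y y'; apply: colP2; rewrite [RHS]mxE [X in _ = X + _]mxE !E !mxE; ring.
Qed.

Lemma br11_linear3 x y : linear (fun z => B x y z).
Proof.
move=> k z z'; apply: colP2; rewrite [RHS]mxE [X in _ = X + _]mxE !E !mxE; ring.
Qed.

Lemma br11_even i j k x y z : x \in P i -> y \in P j -> z \in P k ->
  B x y z \in P (i (+) j (+) k).
Proof.
rewrite !mem_part11.
by case: i; case: j; case: k => /= /eqP hx /eqP hy /eqP hz;
  apply/eqP; rewrite E ?hx ?hy ?hz; ring.
Qed.

Lemma twist11_even i x : x \in P i -> A x \in P i.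
Proof. by rewrite !mem_part11; case: i => /eqP h; apply/eqP; rewrite E h; ring. Qed.

Lemma twist11_br x y z : A (B x y z) = B (A x) (A y) (A z).
Proof.
case: ok => [[c0 t0]|[b0 ca]].
  by apply: colP2; rewrite !E c0 t0; ring.
apply: colP2; rewrite !E b0; last by ring.
by rewrite !mul0r !addr0 mulrA (mulrC a) ca; ring.
Qed.

Lemma br11_skew12 i j k x y z : x \in P i -> y \in P j -> z \in P k ->
  B x y z = - ((-1) ^+ (i * j)%N *: B y x z).
Proof.
rewrite !mem_part11.
by case: i; case: j; case: k => /= /eqP hx /eqP hy /eqP hz;
  apply: colP2; rewrite [RHS]mxE [X in - X]mxE !E ?hx ?hy ?hz; ring.
Qed.

Lemma br11_skew23 i j k x y z : x \in P i -> y \in P j -> z \in P k ->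
  B x y z = - ((-1) ^+ (j * k)%N *: B x z y).
Proof.
rewrite !mem_part11.
by case: i; case: j; case: k => /= /eqP hx /eqP hy /eqP hz;
  apply: colP2; rewrite [RHS]mxE [X in - X]mxE !E ?hx ?hy ?hz; ring.
Qed.

Lemma br11_jacobi i1 i2 j1 j2 j3 x1 x2 y1 y2 y3 :
  x1 \in P i1 -> x2 \in P i2 -> y1 \in P j1 -> y2 \in P j2 -> y3 \in P j3 ->
  B (A x1) (A x2) (B y1 y2 y3) =
    B (B x1 x2 y1) (A y2) (A y3)
    + (-1) ^+ ((i1 + i2) * j1)%N *: B (A y1) (B x1 x2 y2) (A y3)
    + (-1) ^+ ((i1 + i2) * (j1 + j2))%N *: B (A y1) (A y2) (B x1 x2 y3).
Proof.
move=> _ _ _ _ _; move: ((-1) ^+ _) ((-1) ^+ _) => s s'.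
by case: ok => [[c0 t0]|[b0 _]]; apply: colP2; rewrite [RHS]mxE [X in X + _]mxE
  [X in _ + X + _]mxE [X in _ + X]mxE !E ?c0 ?t0 ?b0; ring.
Qed.

Definition std11 : mult3HomLieSuper K :=
  Mult3HomLieSuper part11_sum part11_cap br11_linear1 br11_linear2 br11_linear3
    br11_even twist11_even twist11_br br11_skew12 br11_skew23 br11_jacobi.

End Standard.

Lemma ok1 (a b : K) : ((0 : K) = 0 /\ (0 : K) = 0) \/ (b = 0 /\ 0 * a = 0).
Proof. by left. Qed.

Lemma ok2 (a : K) : ((0 : K) = 0 /\ (1 : K) = 0) \/ ((0 : K) = 0 /\ 0 * a = 0).
Proof. by right; rewrite mul0r. Qed.

Lemma ok3 (t : K) : ((1 : K) = 0 /\ t = 0) \/ ((0 : K) = 0 /\ 1 * (0 : K) = 0).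
Proof. by right; rewrite mulr0. Qed.

Definition g1 (a b : K) : mult3HomLieSuper K := std11 (ok1 a b).
Definition g2 (a : K) : mult3HomLieSuper K := std11 (ok2 a).
Definition g3 : mult3HomLieSuper K := std11 (ok3 0).
Definition g4 (t : K) : mult3HomLieSuper K := std11 (ok3 t).

End Families.

Arguments g3 {K}.

(* Main.v *)
From HB Require Import structures.
Require Import Defs.
From mathcomp Require Import all_boot all_order all_algebra.
From mathcomp Require Import ring.
Set Implicit Arguments.
Unset Strict Implicit.
Unset Printing Implicit Defensive.
Import GRing.Theory Num.Theory.
Local Open Scope ring_scope.
Local Open Scope classical_set_scope.
Local Open Scope complex_scope.

(** Every algebra of the four families is the standard algebra on K^2 with
    [e_1, e_1, e_0] = c e_0, [e_1, e_1, e_1] = t e_1 and alpha = diag (a, b),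
    where either the bracket is zero or b = 0 and c a = 0.  The bracket of
    three vectors vanishes as soon as two of them are multiples of e_0, and
    alpha^k maps into K e_0 when b = 0 and k >= 1.  Each term on the right of
    the Leibniz rule for an alpha^k-derivation has two arguments in the image
    of alpha^k, so the rule says only that D kills the image of the bracket:
    c D(e_0) = 0 and t D(e_1) = 0 [leibniz_std11].  Together with parity and
    D alpha = alpha D this determines all the derivation spaces, uniformly in
    the parameters [derh_std11_even, derh_std11_odd].

    A standard algebra is complete iff c and t are both nonzero
    [complete_std11].  If c = 0, then e_0 is central.  If c <> 0, then
    alpha = 0, so that all inner derivations vanish; when t = 0, the map
    diag (0, 1) is a derivation that is not inner, and when t <> 0 there is no
    nonzero derivation and no nonzero central element.

    It remains to bring an arbitrary algebra of superdimension (1|1) into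
    standard form.  Parity and skew-symmetry leave four constants c, t, a, b.
    The Hom-Jacobi identity on (v, v; v, v, v) gives 2 (b t)^2 = 0, on
    (v, u; v, v, v) it gives 3 (b c)^2 = a c (b t), and multiplicativity gives
    c a = b^2 a c; hence b t = b c = c a = 0, which is the condition for the
    standard algebra to exist [structure_constants_ok].  Completeness is
    invariant under isomorphism [complete_iso], so c and t are nonzero; then
    multiplying v by a square root of 1 / c turns the constants into 1 and
    t / c, which is the fourth family. *)

(** * Trilinearity of the bracket *)

Section Trilinear.
Variables (K : fieldType) (g : mult3HomLieSuper K).

Lemma brD1 k x x' y z : br (k *: x + x') y z = k *: br x y z + br x' y z :> g.
Proof. exact: br_linear1. Qed.
Lemma brD2 k x y y' z : br x (k *: y + y') z = k *: br x y z + br x y' z :> g.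
Proof. exact: br_linear2. Qed.
Lemma brD3 k x y z z' : br x y (k *: z + z') = k *: br x y z + br x y z' :> g.
Proof. exact: br_linear3. Qed.

Lemma br01 y z : br 0 y z = 0 :> g.
Proof. by have := brD1 (-1) 0 0 y z; rewrite scaler0 addr0 scaleN1r addNr. Qed.
Lemma br02 x z : br x 0 z = 0 :> g.
Proof. by have := brD2 (-1) x 0 0 z; rewrite scaler0 addr0 scaleN1r addNr. Qed.
Lemma br03 x y : br x y 0 = 0 :> g.
Proof. by have := brD3 (-1) x y 0 0; rewrite scaler0 addr0 scaleN1r addNr. Qed.
Lemma brZ1 k x y z : br (k *: x) y z = k *: br x y z :> g.
Proof. by have := brD1 k x 0 y z; rewrite br01 !addr0. Qed.
Lemma brZ2 k x y z : br x (k *: y) z = k *: br x y z :> g.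
Proof. by have := brD2 k x y 0 z; rewrite br02 !addr0. Qed.
Lemma brZ3 k x y z : br x y (k *: z) = k *: br x y z :> g.
Proof. by have := brD3 k x y z 0; rewrite br03 !addr0. Qed.

End Trilinear.

Definition brZ := (brZ1, brZ2, brZ3).

(** * Derivations and completeness of the standard algebras *)

Section Standard.
Variables (K : fieldType) (c t a b : K).
Hypothesis ok : (c = 0 /\ t = 0) \/ (b = 0 /\ c * a = 0).

Let G := std11 ok.
Let coordE := (br11_0E, br11_1E, endo0E, endo1E, @eE K).

Lemma endo_coord (D : 'End('cV[K]_2)) :
  D = endo (mx2 (D (e K false) 0 0) (D (e K true) 0 0)
                (D (e K false) 1 0) (D (e K true) 1 0)).
Proof.
apply/lfunP => x.
have -> : x = x 0 0 *: e K false + x 1 0 *: e K true.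
  by apply: colP2; rewrite [RHS]mxE [X in X + _]mxE [X in _ + X]mxE !eE /=; ring.
rewrite !linearD !linearZ /=.
by apply: colP2; rewrite [LHS]mxE [X in X + _ = _]mxE [X in _ + X = _]mxE
  [RHS]mxE [X in _ = X + _]mxE [X in _ = _ + X]mxE !coordE /=; ring.
Qed.

Lemma endo0 : endo (mx2 0 0 0 0) = 0 :> 'End('cV[K]_2).
Proof.
by apply/lfunP => x; rewrite zero_lfunE; apply: colP2; rewrite coordE mxE; ring.
Qed.

Lemma mem_e i : e K i \in part G i.
Proof. by rewrite mem_part11 eE; case: i. Qed.

Lemma twistn_1E k (x : G) : b = 0 -> twistn k.+1 x 1 0 = 0.
Proof.
by move=> b0; rewrite /twistn iterS /= endo1E b0; ring.
Qed.

(** If b = 0, the image of a positive power of alpha is K e_0, and the bracket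
    vanishes when two of its arguments lie there; otherwise it is zero. *)
Lemma br_twistn0 k (x y z : G) :
  [/\ br x (twistn k.+1 y) (twistn k.+1 z) = 0,
      br (twistn k.+1 x) y (twistn k.+1 z) = 0
    & br (twistn k.+1 x) (twistn k.+1 y) z = 0].
Proof.
have brE x' y' z' : @br _ G x' y' z' = br11 c t x' y' z' by [].
case: ok => [[c0 t0]|[b0 _]].
  by split; apply: colP2; rewrite !brE !coordE ?c0 ?t0 mxE; ring.
by split; apply: colP2; rewrite !brE !(br11_0E, br11_1E) !twistn_1E // mxE; ring.
Qed.

(** By [br_twistn0] the right-hand side of the Leibniz rule is zero, whatever the
    parity of D, so that only the vanishing of D on brackets is left. *)
Lemma leibniz_std11 k d (D : 'End(carrier G)) :
  (forall i1 i2 i3 x1 x2 x3,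
     x1 \in part G i1 -> x2 \in part G i2 -> x3 \in part G i3 ->
     D (br x1 x2 x3) =
       br (D x1) (twistn k.+1 x2) (twistn k.+1 x3)
       + (-1) ^+ (d * i1)%N *:
           br (twistn k.+1 x1) (D x2) (twistn k.+1 x3)
       + (-1) ^+ (d * (i1 + i2))%N *:
           br (twistn k.+1 x1) (twistn k.+1 x2) (D x3)) <->
  c *: D (e K false) = 0 /\ t *: D (e K true) = 0.
Proof.
split=> [leib|[cD tD] i1 i2 i3 x1 x2 x3 _ _ _].
  have brD0 i1 i2 i3 x1 x2 x3 : x1 \in part G i1 -> x2 \in part G i2 ->
      x3 \in part G i3 -> D (br x1 x2 x3) = 0.
    move=> h1 h2 h3; rewrite (leib _ _ _ _ _ _ h1 h2 h3).
    have [-> _ _] := br_twistn0 k (D x1) x2 x3.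
    have [_ -> _] := br_twistn0 k x1 (D x2) x3.
    have [_ _ ->] := br_twistn0 k x1 x2 (D x3).
    by rewrite !scaler0 !addr0.
  have := brD0 _ _ _ _ _ _ (mem_e true) (mem_e true) (mem_e true).
  have := brD0 _ _ _ _ _ _ (mem_e true) (mem_e true) (mem_e false).
  by rewrite /= br11_10 br11_11 !linearZ.
have [-> _ _] := br_twistn0 k (D x1) x2 x3.
have [_ -> _] := br_twistn0 k x1 (D x2) x3.
have [_ _ ->] := br_twistn0 k x1 x2 (D x3).
rewrite !scaler0 !addr0 /= /br11 linearD !linearZ /=.
by rewrite [c * _]mulrC [t * _]mulrC -!scalerA cD tD !scaler0 addr0.
Qed.

Lemma derh_std11_even k : derh G k.+1 false =
  [set D | exists m q, [/\ c * m = 0, t * q = 0 & D = endo (mx2 m 0 0 q)]].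
Proof.
apply/seteqP; split=> [D [even _ /leibniz_std11 [cD tD]]|D [m [q [cm tq ->]]]].
  have := even _ _ (mem_e false); rewrite mem_part11 /= => /eqP D10.
  have := even _ _ (mem_e true); rewrite mem_part11 /= => /eqP D01.
  exists (D (e K false) 0 0), (D (e K true) 1 0); split.
  - by have := congr1 (fun x : 'cV_2 => x 0 0) cD; rewrite !mxE.
  - by have := congr1 (fun x : 'cV_2 => x 1 0) tD; rewrite !mxE.
  - by rewrite [LHS]endo_coord D01 D10.
split=> [i x|x|].
- by rewrite !mem_part11; case: i => /eqP x0; apply/eqP; rewrite /= coordE x0; ring.
- by apply: colP2; rewrite /= !coordE; ring.
- apply/leibniz_std11; split; apply: colP2; rewrite !mxE !coordE /=.
  + by rewrite !mulr0 addr0 mulr1.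
  + by ring.
  + by ring.
  + by rewrite !mulr0 add0r mulr1.
Qed.

(** The conditions with a - b say that D commutes with alpha; for an even D,
    which is diagonal, this is automatic. *)
Lemma derh_std11_odd k : derh G k.+1 true =
  [set D | exists n p, [/\ (a - b) * n = 0, (a - b) * p = 0, c * p = 0, t * n = 0
                         & D = endo (mx2 0 n p 0)]].
Proof.
apply/seteqP; split=> [D [odd com /leibniz_std11 [cD tD]]|].
  have := odd _ _ (mem_e false); rewrite mem_part11 /= => /eqP D00.
  have := odd _ _ (mem_e true); rewrite mem_part11 /= => /eqP D11.
  have defD := endo_coord D; rewrite D00 D11 in defD.
  exists (D (e K true) 0 0), (D (e K false) 1 0); split=> //.
  - have := congr1 (fun x : 'cV_2 => x 0 0) (com (e K true)).
    rewrite /= defD !coordE /= !(mulr0, mul0r, addr0, add0r, mulr1) => h.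
    by apply/eqP; rewrite mulrBl subr_eq0 -h mulrC.
  - have := congr1 (fun x : 'cV_2 => x 1 0) (com (e K false)).
    rewrite /= defD !coordE /= !(mulr0, mul0r, addr0, add0r, mulr1) => h.
    by apply/eqP; rewrite mulrBl subr_eq0 -h mulrC.
  - by have := congr1 (fun x : 'cV_2 => x 1 0) cD; rewrite !mxE.
  - by have := congr1 (fun x : 'cV_2 => x 0 0) tD; rewrite !mxE.
move=> D [n [p [abn abp cp tn ->]]].
have {}abn : a * n = b * n by apply/eqP; rewrite -subr_eq0 -mulrBl abn.
have {}abp : a * p = b * p by apply/eqP; rewrite -subr_eq0 -mulrBl abp.
split=> [i x|x|].
- by rewrite !mem_part11; case: i => /eqP x0; apply/eqP; rewrite /= coordE x0; ring.
- apply: colP2; rewrite /= !coordE.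
  + by ring: abn.
  + by ring: abp.
- apply/leibniz_std11; split; apply: colP2; rewrite !mxE !coordE /=.
  + by ring.
  + by rewrite !mulr0 addr0 mulr1.
  + by rewrite !mulr0 add0r mulr1.
  + by ring.
Qed.

Lemma center_std11_c0 : c = 0 -> e K false \in center G.
Proof.
move=> c0; apply/mem_set => x y.
by split; apply: colP2; rewrite /= !coordE ?c0 mxE /=; ring.
Qed.

Lemma center_std11 : c != 0 -> t != 0 -> center G = [set 0].
Proof.
move=> c0 t0; apply/seteqP; split=> [z cz|z -> x y] /=.
  have [z11 _ _] := cz (e K true) (e K true).
  have := congr1 (fun x : 'cV_2 => x 0 0) z11.
  have := congr1 (fun x : 'cV_2 => x 1 0) z11.
  rewrite /= !coordE !mxE /= !(mulr0, mulr1) subr0 add0r => /eqP.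
  rewrite mulf_eq0 (negPf t0) => /eqP z1 /eqP.
  rewrite mulf_eq0 (negPf c0) => /eqP z0.
  by apply: colP2; rewrite mxE ?z0 ?z1.
by split; apply: colP2; rewrite !coordE !mxE; ring.
Qed.

End Standard.

Lemma der0 (K : fieldType) (g : mult3HomLieSuper K) k :
  derh g k false = [set 0] -> derh g k true = [set 0] -> der g k = [set 0].
Proof.
move=> d0 d1; apply/seteqP; split=> [D [D0 [D1 []]]|D ->].
  by rewrite d0 d1 /= => -> -> ->; rewrite addr0.
by exists 0, 0; rewrite d0 d1 /= addr0.
Qed.

(** The generators involve fixed points of alpha, and 0 is the only one. *)
Lemma inn_twist0 (K : fieldType) (g : mult3HomLieSuper K) k :
  (forall x, twist g x = 0) -> inn g k = [set 0].
Proof.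
move=> tw0; apply/seteqP; split=> [D [s [gen_s]]|D ->]; last first.
  by exists [::]; split=> //; rewrite mem0v.
have s0 : (<<s>> <= 0)%VS.
  apply/span_subvP => E /gen_s [i1 [i2 [x1 [x2 [_ _ + _ brE]]]]].
  rewrite tw0 memv0 => x10; apply/eqP/lfunP => y.
  by rewrite zero_lfunE brE -x10 br01.
by move=> /(subvP s0); rewrite memv0 => /eqP.
Qed.

Lemma complete_std11 (K : fieldType) (c t a b : K)
    (ok : (c = 0 /\ t = 0) \/ (b = 0 /\ c * a = 0)) :
  complete (std11 ok) <-> c != 0 /\ t != 0.
Proof.
have tw0 : c != 0 -> forall x, twist (std11 ok) x = 0.
  move=> c0 x; have [[c0' _]|[b0 /eqP]] := ok; first by rewrite c0' eqxx in c0.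
  by rewrite mulf_eq0 (negPf c0) => /eqP a0; rewrite /= a0 b0 endo0 zero_lfunE.
split=> [[cen der_inn]|[c0 t0]]; last first.
  split=> [|k]; first exact: center_std11.
  rewrite inn_twist0; last exact: tw0.
  apply: der0; rewrite ?derh_std11_even ?derh_std11_odd.
    apply/seteqP; split=> [D [m [q [/eqP cm /eqP tq ->]]]|D ->] /=.
      move: cm tq; rewrite !mulf_eq0 (negPf c0) (negPf t0) => /eqP -> /eqP ->.
      exact: endo0.
    by exists 0, 0; rewrite !mulr0 endo0.
  apply/seteqP; split=> [D [n [p [_ _ /eqP cp /eqP tn ->]]]|D ->] /=.
    move: cp tn; rewrite !mulf_eq0 (negPf c0) (negPf t0) => /eqP -> /eqP ->.
    exact: endo0.
  by exists 0, 0; rewrite !mulr0 endo0.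
have c0 : c != 0.
  apply/eqP => /(center_std11_c0 ok); rewrite cen => /set_mem /=.
  move/(congr1 (fun x : 'cV[K]_2 => x 0 0)); rewrite eE mxE => /eqP.
  by rewrite oner_eq0.
split=> //; apply/eqP => t0.
(* With t = 0, the projection onto K e_1 along K e_0 is a derivation. *)
have : der (std11 ok) 1 (endo (mx2 0 0 0 1)).
  exists (endo (mx2 0 0 0 1)), 0; split; last by rewrite addr0.
    by rewrite derh_std11_even; exists 0, 1; rewrite mulr0 t0 mul0r.
  by rewrite derh_std11_odd; exists 0, 0; rewrite !mulr0 endo0.
rewrite der_inn inn_twist0 /=; last exact: tw0.
move/(congr1 (fun D : 'End('cV[K]_2) => D (e K true) 1 0)).
rewrite endo1E zero_lfunE !eE mxE /= => /eqP.
by rewrite mul0r add0r mulr1 oner_eq0.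
Qed.

(** * Invariance under isomorphism *)

Section Transport.
Variable K : fieldType.
Implicit Types g h : mult3HomLieSuper K.

Definition is_hom g h (f : 'Hom(carrier g, carrier h)) : Prop :=
  [/\ forall i x, x \in part g i -> f x \in part h i,
      forall x y z, f (br x y z) = br (f x) (f y) (f z)
    & forall x, f (twist g x) = twist h (f x)].

(** A bijective even map has an even inverse: if f u is of degree i and u has a
    component of the other degree, the image of this component lies in both
    homogeneous parts. *)
Lemma isomorphic_inv g h : isomorphic g h ->
  exists (f : 'Hom(carrier g, carrier h)) (f' : 'Hom(carrier h, carrier g)),
    [/\ is_hom f, is_hom f', cancel f f' & cancel f' f].
Proof.
move=> [f [bij_f even_f br_f tw_f]].
have inj_f := bij_inj bij_f.
have fK : cancel f f^-1%VF by apply/lker0_lfunK/lker0P.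
have f'K : cancel f^-1%VF f by have [f' _ f'K'] := bij_f => y; rewrite -(f'K' y) fK.
exists f, f^-1%VF; split=> //; split=> [i x xi|x y z|x]; last 2 first.
- by apply: inj_f; rewrite br_f !f'K.
- by apply: inj_f; rewrite tw_f !f'K.
have f_other u j : u \in part g j -> f u \in part h (~~ j) -> u = 0.
  move=> uj fuj; apply: inj_f; rewrite linear0; apply/eqP.
  rewrite -memv0 -(part_cap h) memv_cap.
  by have := even_f _ _ uj; case: (j) fuj => -> ->.
have := memvf (f^-1%VF x); rewrite -(part_sum g) => /memv_addP[u0 u0P [u1 u1P xE]].
have fx : f u0 + f u1 = x by rewrite -linearD -xE; apply: f'K.
rewrite xE; case: i xi => xi.
  rewrite (f_other _ _ u0P) ?add0r //.
  by rewrite -[f u0](addrK (f u1)) fx rpredB ?even_f.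
rewrite (f_other _ _ u1P) ?addr0 //.
by rewrite -[f u1](addKr (f u0)) fx addrC rpredB ?even_f.
Qed.

Lemma isomorphic_sym g h : isomorphic g h -> isomorphic h g.
Proof.
move=> /isomorphic_inv[f [f' [_ [? ? ?] fK f'K]]].
by exists f'; split=> //; exists f.
Qed.

Lemma superdim_iso g h m n : isomorphic g h -> superdim g m n -> superdim h m n.
Proof.
move=> /isomorphic_inv[f [f' [[even_f _ _] [even_f' _ _] fK f'K]]].
suff dimE i : \dim (part h i) = \dim (part g i) by rewrite /superdim !dimE.
rewrite -(limg_dim_eq (f := f) (U := part g i)); last first.
  by have /eqP -> : lker f == 0%VS; [exact/lker0P/can_inj|rewrite capv0].
congr (\dim _); apply/vspaceP => y; apply/idP/memv_imgP => [yi|[x xi ->]].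
  by exists (f' y); [exact: even_f'|rewrite f'K].
exact: even_f.
Qed.

Section Pair.
Variables (g h : mult3HomLieSuper K).
Variables (f : 'Hom(carrier g, carrier h)) (f' : 'Hom(carrier h, carrier g)).
Hypotheses (morph_f : is_hom f) (morph_f' : is_hom f').
Hypotheses (fK : cancel f f') (f'K : cancel f' f).

Definition conj_end (D : 'End(carrier g)) : 'End(carrier h) := (f \o (D \o f'))%VF.

Lemma conj_endE D x : conj_end D x = f (D (f' x)).
Proof. by rewrite !comp_lfunE. Qed.

Lemma morph_twistn k x : f (twistn k x) = twistn k (f x).
Proof.
have [_ _ tw] := morph_f.
by rewrite /twistn; elim: k => //= k IHk; rewrite tw IHk.
Qed.

Lemma center_conj z : center g z -> center h (f z).
Proof.
have [_ brf _] := morph_f => cz x y; have [c1 c2 c3] := cz (f' x) (f' y).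
by rewrite -(f'K x) -(f'K y) -!brf c1 c2 c3 linear0.
Qed.

(** The isomorphism and its inverse enter symmetrically here and in the next
    lemmas, which therefore give both inclusions between the spaces of
    derivations, or of inner derivations, of isomorphic algebras. *)
Lemma derh_conj k d D : derh g k d D -> derh h k d (conj_end D).
Proof.
have [evf brf twf] := morph_f; have [evf' brf' twf'] := morph_f'.
move=> [ev com leib]; split=> [i x xi|x|i1 i2 i3 x1 x2 x3 h1 h2 h3].
- by rewrite conj_endE; exact/evf/ev/evf'.
- by rewrite !conj_endE twf' com twf.
- rewrite !conj_endE brf' (leib i1 i2 i3) ?evf' //.
  by rewrite !linearD !linearZ /= !brf !morph_twistn !f'K.
Qed.

Lemma der_conj k D : der g k D -> der h k (conj_end D).
Proof.
move=> [D0 [D1 [der0 der1 ->]]].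
exists (conj_end D0), (conj_end D1); split; [exact: derh_conj..|].
by rewrite /conj_end comp_lfunDl comp_lfunDr.
Qed.

Lemma inn_conj k D : inn g k D -> inn h k (conj_end D).
Proof.
have [evf brf twf] := morph_f.
move=> [s [gen_s sD]]; exists (map conj_end s); split=> [E|].
  move=> /mapP[E0 /gen_s[i1 [i2 [x1 [x2 [x1P x2P tw1 tw2 E0E]]]]] ->].
  exists i1, i2, (f x1), (f x2).
  split; rewrite ?evf -?twf ?tw1 ?tw2 //.
  by move=> y; rewrite conj_endE E0E brf morph_twistn f'K.
rewrite (coord_span (X := in_tuple s) sD).
apply: (big_ind (fun E => conj_end E \in <<map conj_end s>>%VS)).
- by rewrite /conj_end comp_lfun0l comp_lfun0r mem0v.
- by move=> E1 E2 ? ?; rewrite /conj_end comp_lfunDl comp_lfunDr memvD.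
- move=> i _; rewrite /conj_end -comp_lfunZl -comp_lfunZr memvZ // memv_span //.
  by apply/map_f/mem_nth.
Qed.

End Pair.

Lemma complete_iso g h : isomorphic g h -> complete g -> complete h.
Proof.
move=> /isomorphic_inv[f [f' [mf mf' fK f'K]]] [cen_g der_inn].
split=> [|k]; apply/seteqP; split.
- move=> z /(center_conj mf' fK); rewrite cen_g /= => z0.
  by rewrite -(f'K z) z0 linear0.
- move=> _ ->; rewrite -(linear0 f).
  by apply: (center_conj mf f'K); rewrite cen_g.
- move=> D /(der_conj mf' mf fK); rewrite der_inn.
  move=> /(inn_conj mf f'K).
  by congr inn; apply/lfunP => x; rewrite !conj_endE !f'K.
- move=> D /(inn_conj mf' fK); rewrite -der_inn.
  move=> /(der_conj mf mf' f'K).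
  by congr der; apply/lfunP => x; rewrite !conj_endE !f'K.
Qed.

End Transport.

(** * Standard form of the algebras of superdimension (1|1) *)

Section Comb.
Variables (K : fieldType) (V : vectType K) (u v : V).

Definition comb (x : 'cV[K]_2) : V := x 0 0 *: u + x 1 0 *: v.

Lemma comb_linear : linear comb.
Proof.
move=> k x y; rewrite /comb !mxE !scalerDl scalerDr !scalerA -!addrA.
by congr (_ + _); rewrite addrCA.
Qed.

HB.instance Definition _ := GRing.isLinear.Build K 'cV[K]_2 V *:%R comb comb_linear.

End Comb.

Section Classification.
Variables (K : fieldType) (g : mult3HomLieSuper K) (u v : g).
Hypotheses (u_nz : u != 0) (v_nz : v != 0).
Hypotheses (uP : part g false = <[u]>%VS) (vP : part g true = <[v]>%VS).

Let u_even : u \in part g false. Proof. by rewrite uP memv_line. Qed.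
Let v_odd : v \in part g true. Proof. by rewrite vP memv_line. Qed.

Lemma structure_constants : exists c t a b,
  [/\ br v v u = c *: u, br v v v = t *: v, twist g u = a *: u & twist g v = b *: v].
Proof.
have := br_even v_odd v_odd u_even; rewrite /= uP => /vlineP[c vvu].
have := br_even v_odd v_odd v_odd; rewrite /= vP => /vlineP[t vvv].
have := twist_even u_even; rewrite uP => /vlineP[a tu].
have := twist_even v_odd; rewrite vP => /vlineP[b tv].
by exists c, t, a, b.
Qed.

Section Constants.
Variables c t a b : K.
Hypotheses (vvu : br v v u = c *: u) (vvv : br v v v = t *: v).
Hypotheses (tw_u : twist g u = a *: u) (tw_v : twist g v = b *: v).
Hypotheses (two_nz : 2%:R != 0 :> K) (three_nz : 3%:R != 0 :> K).

Let vuv : br v u v = - c *: u.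
Proof. by rewrite (br_skew23 v_odd u_even v_odd) expr0 scale1r vvu scaleNr. Qed.

Let uvv : br u v v = c *: u.
Proof. by rewrite (br_skew12 u_even v_odd v_odd) expr0 scale1r vuv scaleNr opprK. Qed.

Let opp_eq0 (x : g) : x = - x -> x = 0.
Proof.
move/eqP; rewrite -subr_eq0 opprK -mulr2n -scaler_nat scaler_eq0 (negPf two_nz).
by move/eqP.
Qed.

Let uuv : br u u v = 0.
Proof. by apply: opp_eq0; rewrite {1}(br_skew12 u_even u_even v_odd) scale1r. Qed.

Let uuu : br u u u = 0.
Proof. by apply: opp_eq0; rewrite {1}(br_skew12 u_even u_even u_even) scale1r. Qed.

Let uvu : br u v u = 0.
Proof. by rewrite (br_skew23 u_even v_odd u_even) expr0 uuv scaler0 oppr0. Qed.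

Let vuu : br v u u = 0.
Proof. by apply: opp_eq0; rewrite {1}(br_skew23 v_odd u_even u_even) scale1r. Qed.

(** The two instances of the Hom-Jacobi identity contribute the factors 2 and 3,
    hence the hypotheses on the characteristic. *)
Lemma structure_constants_ok : (c = 0 /\ t = 0) \/ (b = 0 /\ c * a = 0).
Proof.
have scaleI (w : g) p q : w != 0 -> p *: w = q *: w -> p = q.
  move=> w0 /eqP; rewrite -subr_eq0 -scalerBl scaler_eq0 (negPf w0) orbF subr_eq0.
  by move/eqP.
have bt : b * t = 0.
  (* The identity reads (b t)^2 = 3 (b t)^2. *)
  have := hom_jacobi v_odd v_odd v_odd v_odd v_odd.
  rewrite (_ : ((true + true) * true)%N = 2%N) //
    (_ : ((true + true) * (true + true))%N = 4%N) //.
  rewrite !(tw_v, vvv, brZ) !scalerA -!scalerDl => /(scaleI _ _ _ v_nz)/eqP.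
  rewrite -subr_eq0 (_ : _ - _ = - (2%:R * (b * t) ^+ 2)); last by ring.
  by rewrite oppr_eq0 mulf_eq0 (negPf two_nz) expf_eq0 => /eqP.
have bc : b * c = 0.
  (* The identity reads - a c (b t) = - 3 (b c)^2. *)
  have := hom_jacobi v_odd u_even v_odd v_odd v_odd.
  rewrite (_ : ((true + false) * true)%N = 1%N) //
    (_ : ((true + false) * (true + true))%N = 2%N) //.
  rewrite !(tw_v, tw_u, vvv, vvu, vuv, uvv, brZ) !scalerA -!scalerDl.
  move=> /(scaleI _ _ _ u_nz)/eqP; rewrite -subr_eq0.
  rewrite (_ : _ - _ = 3%:R * (b * c) ^+ 2 - a * c * (b * t)); last by ring.
  by rewrite bt mulr0 subr0 mulf_eq0 (negPf three_nz) expf_eq0 => /eqP.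
have ca : c * a = 0.
  have := twist_br v v u; rewrite vvu linearZ /= !(tw_v, tw_u, vvu, brZ) !scalerA.
  by move=> /(scaleI _ _ _ u_nz) ->; ring: bc.
have [b0|b_nz] := eqVneq b 0; [by right|left].
by split; apply/eqP; [move/eqP: bc|move/eqP: bt]; rewrite mulf_eq0 (negPf b_nz).
Qed.

(** The bracket of the basis vectors not among the constants is forced by
    skew-symmetry, so that expanding by trilinearity gives back the standard
    bracket. *)
Lemma std11_iso (ok : (c = 0 /\ t = 0) \/ (b = 0 /\ c * a = 0)) :
  isomorphic (std11 ok) g.
Proof.
pose f : 'Hom('cV[K]_2, carrier g) := linfun (comb u v).
have fE x : f x = x 0 0 *: u + x 1 0 *: v by rewrite lfunE.
have inj_f : lker f == 0%VS.
  rewrite -subv0; apply/subvP => x; rewrite memv_ker fE memv0 addr_eq0 => /eqP xuv.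
  have x0u : x 0 0 *: u = 0.
    apply/eqP; rewrite -memv0 -(part_cap g) memv_cap uP vP memvZ ?memv_line //=.
    by rewrite xuv rpredN memvZ ?memv_line.
  move: (xuv); rewrite x0u => /esym/eqP; rewrite oppr_eq0 scaler_eq0 (negPf v_nz) orbF.
  move: x0u => /eqP; rewrite scaler_eq0 (negPf u_nz) orbF => /eqP x0 /eqP x1.
  by apply/eqP/colP2; rewrite mxE ?x0 ?x1.
have surj_f y : y \in limg f.
  have := memvf y; rewrite -(part_sum g) uP vP.
  move=> /memv_addP[_ /vlineP[m ->] [_ /vlineP[n ->] ->]].
  apply/memv_imgP; exists (\col_i if i == 0 then m else n); first exact: memvf.
  by rewrite fE !mxE.
exists f; split.
- exists f^-1%VF; first exact: lker0_lfunK.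
  by move=> y; rewrite limg_lfunVK.
- move=> i x; rewrite mem_part11 fE; case: i => /eqP ->; rewrite scale0r.
    by rewrite add0r memvZ.
  by rewrite addr0 memvZ.
- move=> x y z; rewrite !fE br11_0E br11_1E.
  rewrite !(brD1, brD2, brD3, brZ, scalerDr, scalerDl).
  rewrite !(uuu, uuv, uvu, vuu, uvv, vuv, vvu, vvv) !(scaler0, add0r, addr0).
  rewrite !scalerA !addrA -!scalerDl; congr (_ *: _ + _ *: _); ring.
- move=> x; rewrite /= !fE endo0E endo1E linearD !linearZ /= tw_u tw_v !scalerA.
  by congr (_ *: _ + _ *: _); ring.
Qed.

End Constants.
End Classification.

Lemma superdim_std11 (K : fieldType) (c t a b : K)
    (ok : (c = 0 /\ t = 0) \/ (b = 0 /\ c * a = 0)) : superdim (std11 ok) 1 1.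
Proof.
have e_nz i : e K i != 0.
  apply/eqP => /(congr1 (fun x : 'cV[K]_2 => x (if i then 1 else 0) 0)).
  by rewrite eE mxE; case: i => /eqP; rewrite oner_eq0.
by rewrite /superdim /= !dim_vline !e_nz.
Qed.

Lemma superdim11_line (K : fieldType) (g : mult3HomLieSuper K) i :
  \dim (part g i) = 1 -> exists2 w : g, w != 0 & part g i = <[w]>%VS.
Proof.
move=> dim1; have w_nz : vpick (part g i) != 0 by rewrite vpick0 -dimv_eq0 dim1.
exists (vpick (part g i)) => //; apply/eqP.
by rewrite eq_sym eqEdim dim_vline w_nz dim1 andbT -memvE memv_pick.
Qed.

Lemma complete_g4 (K : numClosedFieldType) (g : mult3HomLieSuper K) :
  superdim g 1 1 /\ complete g <-> exists t : K, t <> 0 /\ isomorphic g (g4 t).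
Proof.
split=> [[[dim0 dim1] cpl_g]|[t [/eqP t0 g_iso]]]; last first.
  have iso_g := isomorphic_sym g_iso; split.
    by apply: superdim_iso iso_g _; apply: superdim_std11.
  by apply: complete_iso iso_g _; apply/complete_std11; rewrite oner_neq0.
have [u u_nz uP] := superdim11_line dim0.
have [v v_nz vP] := superdim11_line dim1.
have two_nz : 2%:R != 0 :> K by rewrite pnatr_eq0.
have three_nz : 3%:R != 0 :> K by rewrite pnatr_eq0.
have [c [t [a [b [vvu vvv tw_u tw_v]]]]] := structure_constants uP vP.
have ok := structure_constants_ok u_nz v_nz uP vP vvu vvv tw_u tw_v two_nz three_nz.
have iso_std := std11_iso u_nz v_nz uP vP vvu vvv tw_u tw_v two_nz ok.
have /complete_std11[c_nz t_nz] := complete_iso (isomorphic_sym iso_std) cpl_g.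
have [[c0 _]|[b0 /eqP]] := ok; first by rewrite c0 eqxx in c_nz.
rewrite mulf_eq0 (negPf c_nz) => /eqP a0.
(* The constants c and t are quadratic in v; r is chosen to turn c into 1. *)
have [r r2 r_nz] : exists2 r : K, r ^+ 2 = c^-1 & r != 0.
  exists (sqrtC c^-1); first exact: sqrtCK.
  by rewrite sqrtC_eq0 invr_eq0.
have rv_nz : r *: v != 0 by rewrite scaler_eq0 negb_or r_nz.
have rvP : part g true = <[r *: v]>%VS.
  apply/eqP; rewrite vP eqEsubv -!memvE memvZ ?memv_line // andbT.
  by rewrite -[X in X \in _](scalerK r_nz) memvZ ?memv_line.
have vvu' : br (r *: v) (r *: v) u = 1 *: u.
  by rewrite !brZ vvu !scalerA -expr2 r2 mulVf.
have vvv' : br (r *: v) (r *: v) (r *: v) = (r ^+ 2 * t) *: (r *: v).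
  by rewrite !brZ vvv !scalerA; congr (_ *: _); ring.
have tw_v' : twist g (r *: v) = 0 *: (r *: v).
  by rewrite linearZ /= tw_v b0 !scale0r scaler0.
rewrite a0 in tw_u.
exists (r ^+ 2 * t); split.
  by apply/eqP; rewrite mulf_eq0 expf_eq0 negb_or (negPf r_nz).
apply/isomorphic_sym.
exact: (std11_iso u_nz rv_nz uP rvP vvu' vvv' tw_u tw_v' two_nz (ok3 _)).
Qed.

(** * The theorem *)

Theorem theorem4p12 (R : realType) :
  (forall k : nat, (1 <= k)%N ->
    [/\ forall a b : R[i],
          [/\ derh (g1 a b) k false =
                [set D | exists m q : R[i], D = endo (mx2 m 0 0 q)],
              a = b -> derh (g1 a b) k true =
                [set D | exists n p : R[i], D = endo (mx2 0 n p 0)]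
            & a <> b -> derh (g1 a b) k true = [set 0]],
        forall a : R[i],
          [/\ derh (g2 a) k false =
                [set D | exists m : R[i], D = endo (mx2 m 0 0 0)],
              a = 0 -> derh (g2 a) k true =
                [set D | exists p : R[i], D = endo (mx2 0 0 p 0)]
            & a <> 0 -> derh (g2 a) k true = [set 0]],
        derh (@g3 R[i]) k false =
          [set D | exists q : R[i], D = endo (mx2 0 0 0 q)] /\
        derh (@g3 R[i]) k true =
          [set D | exists n : R[i], D = endo (mx2 0 n 0 0)]
      & forall t : R[i], t <> 0 -> der (g4 t) k = [set 0]])
  /\
  (forall g : mult3HomLieSuper R[i],
    superdim g 1 1 /\ complete g <->
    exists t : R[i], t <> 0 /\ isomorphic g (g4 t)).
Proof.
split=> [[//|k] _|]; last exact: complete_g4.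
split=> [a b|a||t /eqP t_nz].
- split=> [|->|/eqP ab]; rewrite ?derh_std11_even ?derh_std11_odd.
  + apply/seteqP; split=> D; first by move=> [m [q [_ _ ->]]]; exists m, q.
    by move=> [m [q ->]]; exists m, q; rewrite !mul0r.
  + apply/seteqP; split=> D; first by move=> [n [p [_ _ _ _ ->]]]; exists n, p.
    by move=> [n [p ->]]; exists n, p; rewrite subrr !mul0r.
  + apply/seteqP; split=> D.
      move=> [n [p [/eqP n0 /eqP p0 _ _ ->]]].
      move: n0 p0; rewrite !mulf_eq0 subr_eq0 (negPf ab) => /eqP -> /eqP ->.
      exact: endo0.
    by move=> ->; exists 0, 0; rewrite !mulr0 endo0.
- split=> [|->|/eqP a_nz]; rewrite ?derh_std11_even ?derh_std11_odd.
  + apply/seteqP; split=> D.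
      by move=> [m [q [_ q0 ->]]]; exists m; rewrite mul1r in q0; rewrite q0.
    by move=> [m ->]; exists m, 0; rewrite mul0r mulr0.
  + apply/seteqP; split=> D.
      by move=> [n [p [_ _ _ n0 ->]]]; exists p; rewrite mul1r in n0; rewrite n0.
    by move=> [p ->]; exists 0, p; rewrite subrr !mul0r mulr0.
  + apply/seteqP; split=> D.
      move=> [n [p [_ /eqP p0 _ n0 ->]]].
      move: n0 p0; rewrite mul1r mulf_eq0 subr0 (negPf a_nz) => -> /eqP ->.
      exact: endo0.
    by move=> ->; exists 0, 0; rewrite !mulr0 endo0.
- rewrite derh_std11_even derh_std11_odd; split; apply/seteqP; split=> D.
  + by move=> [m [q [m0 _ ->]]]; exists q; rewrite mul1r in m0; rewrite m0.
  + by move=> [q ->]; exists 0, q; rewrite mul0r mulr0.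
  + by move=> [n [p [_ _ p0 _ ->]]]; exists n; rewrite mul1r in p0; rewrite p0.
  + by move=> [n ->]; exists n, 0; rewrite subrr !mul0r mulr0.
- have [_ der_inn] : complete (g4 t) by apply/complete_std11; rewrite oner_neq0.
  rewrite der_inn inn_twist0 // => x.
  by rewrite /= endo0 zero_lfunE.
Qed.
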